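(* Let $M=\begin{pmatrix}A&B\\ C&D\end{pmatrix}$ be an operator matrix on $X\oplus Y$, where $A\in\mathcal{L}(X)$ and $D\in\mathcal{L}(Y)$ have g-Drazin inverses, $B\in\mathcal{L}(Y,X)$, $C\in\mathcal{L}(X,Y)$. If $ABC=0$, $DCA=0$, $DCB=0$, $CBCA=0$ and $CBCB=0$, then $M$ has a g-Drazin inverse in $\mathcal{L}(X\oplus Y)$.
   Context: $X,Y$ are complex Banach spaces; $\mathcal{L}(X)$ denotes the Banach algebra of bounded linear operators on $X$, and $\mathcal{L}(Y,X)$ the bounded operators from $Y$ to $X$. An element $a$ of a unital Banach algebra $\mathcal{A}$ is quasinilpotent if $\lim_{n\to\infty}\|a^n\|^{1/n}=0$. An element $a\in\mathcal{A}$ has a g-Drazin (generalized Drazin) inverse if there exists $x\in\mathcal{A}$ with $x=xax$, $ax=xa$, and $a-a^2x$ quasinilpotent; such $x$ is unique and is denoted $a^d$. *)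

(* Defs.v *)
From Stdlib Require Import Reals.
Open Scope R_scope.

Record C := mkC { Re : R; Im : R }.
Definition C0 : C := mkC 0 0.
Definition C1 : C := mkC 1 0.
Definition Cadd (a b : C) : C := mkC (Re a + Re b) (Im a + Im b).
Definition Cmul (a b : C) : C :=
  mkC (Re a * Re b - Im a * Im b) (Re a * Im b + Im a * Re b).
Definition Cabs (a : C) : R := sqrt (Re a * Re a + Im a * Im a).

Record NormedOps := {
  V :> Type;
  vzero : V;
  vadd : V -> V -> V;
  vopp : V -> V;
  vscal : C -> V -> V;
  vnorm : V -> R
}.
Arguments vzero {n}.
Arguments vadd {n} _ _.
Arguments vopp {n} _.
Arguments vscal {n} _ _.
Arguments vnorm {n} _.

Definition vsub {X : NormedOps} (x y : X) : X := vadd x (vopp y).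

Record Banach := {
  bops :> NormedOps;
  add_assoc : forall x y z : bops, vadd x (vadd y z) = vadd (vadd x y) z;
  add_comm : forall x y : bops, vadd x y = vadd y x;
  add_zero : forall x : bops, vadd x vzero = x;
  add_opp : forall x : bops, vadd x (vopp x) = vzero;
  scal_one : forall x : bops, vscal C1 x = x;
  scal_assoc : forall (a b : C) (x : bops), vscal a (vscal b x) = vscal (Cmul a b) x;
  scal_distr_v : forall (a : C) (x y : bops), vscal a (vadd x y) = vadd (vscal a x) (vscal a y);
  scal_distr_s : forall (a b : C) (x : bops), vscal (Cadd a b) x = vadd (vscal a x) (vscal b x);
  norm_nonneg : forall x : bops, 0 <= vnorm x;
  norm_zero : forall x : bops, vnorm x = 0 -> x = vzero;
  norm_scal : forall (a : C) (x : bops), vnorm (vscal a x) = Cabs a * vnorm x;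
  norm_triangle : forall x y : bops, vnorm (vadd x y) <= vnorm x + vnorm y;
  complete : forall u : nat -> bops,
    (forall eps, 0 < eps -> exists N, forall m n, (N <= m)%nat -> (N <= n)%nat ->
        vnorm (vsub (u m) (u n)) < eps) ->
    exists l : bops, forall eps, 0 < eps -> exists N, forall n, (N <= n)%nat ->
        vnorm (vsub (u n) l) < eps
}.

Definition prod_ops (X Y : NormedOps) : NormedOps := {|
  V := (X * Y)%type;
  vzero := (vzero, vzero);
  vadd := fun p q => (vadd (fst p) (fst q), vadd (snd p) (snd q));
  vopp := fun p => (vopp (fst p), vopp (snd p));
  vscal := fun a p => (vscal a (fst p), vscal a (snd p));
  vnorm := fun p => vnorm (fst p) + vnorm (snd p)
|}.

Definition bounded_linear {X Y : NormedOps} (T : X -> Y) : Prop :=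
  (forall x y, T (vadd x y) = vadd (T x) (T y)) /\
  (forall a x, T (vscal a x) = vscal a (T x)) /\
  (exists K, forall x, vnorm (T x) <= K * vnorm x).

Definition opnorm_le {X Y : NormedOps} (T : X -> Y) (c : R) : Prop :=
  forall x, vnorm (T x) <= c * vnorm x.

(** Quasinilpotent: lim ||T^n||^(1/n) = 0, i.e. for every eps > 0,
    eventually ||T^n|| <= eps^n. *)
Definition quasinilpotent {X : NormedOps} (T : X -> X) : Prop :=
  forall eps, 0 < eps -> exists N, forall n, (N <= n)%nat ->
    opnorm_le (Nat.iter n T) (eps ^ n).

Definition gDrazin_inverse {X : NormedOps} (a s : X -> X) : Prop :=
  bounded_linear s /\
  (forall z, s (a (s z)) = s z) /\
  (forall z, a (s z) = s (a z)) /\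
  quasinilpotent (fun z => vsub (a z) (a (a (s z)))).

Definition has_gDrazin {X : NormedOps} (a : X -> X) : Prop :=
  exists s, gDrazin_inverse a s.

Definition opmatrix {X Y : NormedOps} (A : X -> X) (B : Y -> X) (Cc : X -> Y)
  (D : Y -> Y) : prod_ops X Y -> prod_ops X Y :=
  fun p => (vadd (A (fst p)) (B (snd p)), vadd (Cc (fst p)) (D (snd p))).

(* Main.v *)
Require Import Defs.
From Stdlib Require Import Reals.
From Stdlib Require Import Lra Lia ssreflect ClassicalEpsilon.

(** Let [T] be [M] with the corner [Cc] erased. The hypotheses give the identities
    [M^3 T = M^2 T^2], [T^2 M^2 = T^3 M], [M^4 = M^2 T M] and [T^2 M T = T^4], which say that
    [U = M^2 T] and [W = T^2 M] satisfy [M U = U T], [W M = T W], [U W = M^6] and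
    [W U = T^6]. Hence if [s] is the g-Drazin inverse of [T], then [U s^7 W] is that of [M].
    The triangular [T] is treated by writing the corner of its inverse as a sum of solutions
    of two equations [Z = B + F Z G] with [F] or [G] quasinilpotent. *)

Local Infix "⊕" := vadd (at level 50, left associativity).
Local Notation "⊖ x" := (vopp x) (at level 35, right associativity).
Local Notation "f ^^ n" := (Nat.iter n f) (at level 30).

(** * Additive group of a Banach space *)

Lemma zero_add {X : Banach} (x : X) : vzero ⊕ x = x.
Proof. by rewrite add_comm add_zero. Qed.

Lemma add_left_comm {X : Banach} (x y z : X) : x ⊕ (y ⊕ z) = y ⊕ (x ⊕ z).
Proof. by rewrite !add_assoc (add_comm _ x). Qed.

Lemma add_opp_cancel {X : Banach} (x y : X) : x ⊕ (⊖ x ⊕ y) = y.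
Proof. by rewrite add_assoc add_opp zero_add. Qed.

Lemma opp_unique {X : Banach} (x y : X) : x ⊕ y = vzero -> y = ⊖ x.
Proof. by move=> h; rewrite -(add_opp_cancel x y) add_left_comm h add_zero. Qed.

Lemma opp_zero {X : Banach} : ⊖ (vzero : X) = vzero.
Proof. by rewrite -(opp_unique vzero vzero) // add_zero. Qed.

Lemma opp_opp {X : Banach} (x : X) : ⊖ (⊖ x) = x.
Proof. by rewrite -(opp_unique (⊖ x) x) // add_comm add_opp. Qed.

Lemma opp_add {X : Banach} (x y : X) : ⊖ (x ⊕ y) = ⊖ x ⊕ ⊖ y.
Proof.
by rewrite -(opp_unique (x ⊕ y) (⊖ x ⊕ ⊖ y)) // -add_assoc (add_left_comm y) add_opp_cancel add_opp.
Qed.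

Lemma sub_eq_zero {X : Banach} (x y : X) : x ⊕ ⊖ y = vzero -> x = y.
Proof. by move=> h; rewrite -(opp_opp y) (opp_unique (⊖ y) x) // add_comm. Qed.

(** The inductive step of [pull], which searches a right-nested sum for the atom [t] and returns a
    proof that the sum equals [t] plus the rest. *)
Lemma pull_step {X : Banach} (s t r r' : X) : r = t ⊕ r' -> s ⊕ r = t ⊕ (s ⊕ r').
Proof. by move=> ->; rewrite add_left_comm. Qed.

Lemma cancel_add {X : Banach} (t r r' : X) : r = ⊖ t ⊕ r' -> t ⊕ r = r'.
Proof. by move=> ->; rewrite add_opp_cancel. Qed.

Lemma cancel_opp {X : Banach} (t r r' : X) : r = t ⊕ r' -> ⊖ t ⊕ r = r'.
Proof. by move=> ->; rewrite add_left_comm add_opp_cancel. Qed.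

Ltac pull t e :=
  lazymatch e with
  | vadd t ?r => constr:(eq_refl e)
  | vadd ?s ?r => let p := pull t r in constr:(pull_step s _ _ _ p)
  end.

(* Equality in an abelian group: everything is moved to the left-hand side as a
   list of signed atoms ending in zero, and opposite atoms are cancelled. *)
Ltac abel :=
  rewrite /vsub; apply: sub_eq_zero; rewrite -[LHS]add_zero;
  rewrite ?(opp_add, opp_opp, opp_zero) -?add_assoc ?(zero_add, add_zero);
  (* The simplification has also erased the final zero; it is put back so that every atom, the last
     one included, heads a sum. *)
  try match goal with |- vadd _ _ = _ => rewrite -[LHS]add_zero -?add_assoc end;
  repeat match goal with
  | |- vadd (vopp ?t) ?r = vzero =>
      let p := pull t r in rewrite (cancel_opp t _ _ p)
  | |- vadd ?t ?r = vzero =>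
      let p := pull (vopp t) r in rewrite (cancel_add t _ _ p)
  end; reflexivity.

(** * Bounded linear operators *)

Lemma blD {X Y : Banach} {f : X -> Y} (hf : bounded_linear f) (x y : X) :
  f (x ⊕ y) = f x ⊕ f y.
Proof. by case: hf. Qed.

Lemma bl0 {X Y : Banach} {f : X -> Y} (hf : bounded_linear f) : f vzero = vzero.
Proof.
have h := blD hf vzero vzero; rewrite add_zero in h.
by rewrite -(add_opp_cancel (f vzero) (f vzero)) add_left_comm -h add_comm add_opp.
Qed.

Lemma blN {X Y : Banach} {f : X -> Y} (hf : bounded_linear f) (x : X) :
  f (⊖ x) = ⊖ f x.
Proof. by apply: opp_unique; rewrite -(blD hf) add_opp (bl0 hf). Qed.

Ltac linear :=
  rewrite /vsub;
  repeat match goal with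
  | H : bounded_linear ?f |- context [?f (vadd ?x ?y)] => rewrite (blD H x y)
  | H : bounded_linear ?f |- context [?f (vopp ?x)] => rewrite (blN H x)
  | H : bounded_linear ?f |- context [?f vzero] => rewrite (bl0 H)
  end.

Lemma scal_zero {X : Banach} (x : X) : vscal C0 x = vzero.
Proof.
have h := scal_distr_s X C0 C0 x.
have e : Cadd C0 C0 = C0 by rewrite /Cadd /C0 /=; congr mkC; ring.
rewrite e in h.
by rewrite -(add_opp_cancel (vscal C0 x) (vscal C0 x)) add_left_comm -h add_comm add_opp.
Qed.

(** Through this identity the homogeneity of norms and of operators carries over to opposites. *)
Lemma opp_scal {X : Banach} (x : X) : ⊖ x = vscal (mkC (-1) 0) x.
Proof.
symmetry; apply: opp_unique.
rewrite -{1}(scal_one X x) -scal_distr_s -(scal_zero x).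
by congr vscal; rewrite /Cadd /C0 /=; congr mkC; ring.
Qed.

Lemma scal_opp {X : Banach} (a : Defs.C) (x : X) : vscal a (⊖ x) = ⊖ vscal a x.
Proof.
rewrite !opp_scal !scal_assoc; congr vscal.
by rewrite /Cmul /=; congr mkC; ring.
Qed.

Lemma norm_opp {X : Banach} (x : X) : vnorm (⊖ x) = vnorm x.
Proof.
rewrite opp_scal norm_scal /Cabs /=.
have -> : (-1 * -1 + 0 * 0 = 1) by ring.
by rewrite sqrt_1 Rmult_1_l.
Qed.

Lemma norm0 {X : Banach} : vnorm (vzero : X) = 0%R.
Proof.
rewrite -(scal_zero vzero) norm_scal /Cabs /=.
have -> : (0 * 0 + 0 * 0 = 0) by ring.
by rewrite sqrt_0 Rmult_0_l.
Qed.

Lemma norm_sub_triangle {X : Banach} (x y z : X) :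
  (vnorm (vsub x z) <= vnorm (vsub x y) + vnorm (vsub y z)).
Proof.
have -> : vsub x z = vsub x y ⊕ vsub y z by abel.
exact: norm_triangle.
Qed.

(** The constant in [bounded_linear] may be negative, for instance on the zero space; its absolute
    value is a bound that can be multiplied with others. *)
Lemma bl_bound {X Y : Banach} {f : X -> Y} (hf : bounded_linear f) :
  exists K, (0 <= K) /\ opnorm_le f K.
Proof.
case: hf => _ [_ [K hK]]; exists (Rabs K); split; first exact: Rabs_pos.
move=> x; apply: Rle_trans (hK x) _.
by apply: Rmult_le_compat_r; [exact: norm_nonneg | exact: Rle_abs].
Qed.

Lemma opnorm_le_comp {X Y Z : Banach} (f : Y -> Z) (g : X -> Y) K L :
  (0 <= K) -> opnorm_le f K -> opnorm_le g L -> opnorm_le (fun x => f (g x)) (K * L).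
Proof.
move=> hK hf hg x; apply: Rle_trans (hf _) _.
by rewrite Rmult_assoc; apply: Rmult_le_compat_l.
Qed.

Lemma bl_comp {X Y Z : Banach} {f : Y -> Z} {g : X -> Y} :
  bounded_linear f -> bounded_linear g -> bounded_linear (fun x => f (g x)).
Proof.
move=> hf hg; split; [|split].
- by move=> x y; rewrite (blD hg) (blD hf).
- by case: hf => _ [hf _]; case: hg => _ [hg _] a x; rewrite hg hf.
- have [K [K0 hK]] := bl_bound hf; have [L [_ hL]] := bl_bound hg.
  by exists (K * L); apply: opnorm_le_comp.
Qed.

Lemma bl_add {X Y : Banach} {f g : X -> Y} :
  bounded_linear f -> bounded_linear g -> bounded_linear (fun x => f x ⊕ g x).
Proof.
move=> hf hg; split; [|split].
- by move=> x y; rewrite (blD hf) (blD hg); abel.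
- by case: hf => _ [hf _]; case: hg => _ [hg _] a x; rewrite hg hf scal_distr_v.
- have [K [_ hK]] := bl_bound hf; have [L [_ hL]] := bl_bound hg.
  exists (K + L) => x; apply: Rle_trans (norm_triangle _ _ _) _.
  by rewrite Rmult_plus_distr_r; apply: Rplus_le_compat.
Qed.

Lemma bl_opp {X Y : Banach} {f : X -> Y} :
  bounded_linear f -> bounded_linear (fun x => ⊖ f x).
Proof.
move=> hf; split; [|split].
- by move=> x y; rewrite (blD hf) opp_add.
- by case: hf => _ [hf _] a x; rewrite hf scal_opp.
- by have [K [_ hK]] := bl_bound hf; exists K => x; rewrite norm_opp.
Qed.

Lemma bl_sub {X Y : Banach} {f g : X -> Y} :
  bounded_linear f -> bounded_linear g -> bounded_linear (fun x => vsub (f x) (g x)).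
Proof. by move=> hf hg; apply: (bl_add hf (bl_opp hg)). Qed.

Lemma bl_id {X : Banach} : bounded_linear (fun x : X => x).
Proof. by do 2!split=> //; exists 1%R => x; lra. Qed.

Lemma bl_zero {X Y : Banach} : bounded_linear (fun _ : X => vzero : Y).
Proof.
split; [|split].
- by rewrite add_zero.
- move=> a _; have e : vscal a (vzero : Y) = vscal a (vscal C0 vzero) by rewrite scal_zero.
  rewrite e scal_assoc -[LHS](scal_zero vzero); congr vscal.
  by rewrite /Cmul /C0 /=; congr mkC; ring.
- by exists 0%R => x; rewrite norm0; lra.
Qed.

Lemma bl_iter {X : Banach} {f : X -> X} n : bounded_linear f -> bounded_linear (f ^^ n).
Proof.
move=> hf; elim: n => [|n IH]; first exact: bl_id.
exact: (bl_comp hf IH).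
Qed.

Ltac bl := repeat first [ assumption | apply: bl_zero | apply: bl_id | apply: bl_iter
  | apply: bl_sub | apply: bl_add | apply: bl_opp
  | match goal with H : bounded_linear ?f |- bounded_linear (fun x => ?f _) => apply: (bl_comp H) end ].

(** * Growth of powers and quasinilpotence *)

Lemma opnorm_le_iter {X : Banach} (f : X -> X) K n :
  (0 <= K) -> opnorm_le f K -> opnorm_le (f ^^ n) (K ^ n).
Proof.
move=> hK hf; elim: n => [|n IH] /=; first by move=> x /=; lra.
exact: opnorm_le_comp.
Qed.

Lemma opnorm_le_weaken {X Y : Banach} (f : X -> Y) K L :
  (K <= L) -> opnorm_le f K -> opnorm_le f L.
Proof.
move=> h hf x; apply: Rle_trans (hf x) _.
by apply: Rmult_le_compat_r => //; exact: norm_nonneg.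
Qed.

Lemma half_pow_small K eps : (0 < eps) ->
  exists N, forall n, (N <= n)%nat -> (K * (/2) ^ n < eps).
Proof.
move=> he.
have hK : (0 < 1 + Rabs K) by have := Rabs_pos K; lra.
have h2 : (Rabs (/2) < 1) by rewrite Rabs_pos_eq; lra.
have [N hN] := pow_lt_1_zero (/2) h2 (eps / (1 + Rabs K)) (Rdiv_lt_0_compat _ _ he hK).
exists N => n /hN h.
have p0 : (0 < (/2) ^ n) by apply: pow_lt; lra.
rewrite (Rabs_pos_eq _ (Rlt_le _ _ p0)) in h.
have := Rle_abs K => hK'.
apply: (Rlt_le_trans _ ((1 + Rabs K) * (/2) ^ n)).
  by apply: Rmult_lt_compat_r => //; lra.
have -> : eps = ((1 + Rabs K) * (eps / (1 + Rabs K))) by field; lra.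
by apply: Rmult_le_compat_l; lra.
Qed.

Lemma quasinilpotent_bound {X : Banach} {T : X -> X} (eps : R) :
  bounded_linear T -> quasinilpotent T -> (0 < eps) ->
  exists K, (0 <= K) /\ forall n, opnorm_le (T ^^ n) (K * eps ^ n).
Proof.
move=> hT hq he; have [N hN] := hq eps he; have [L [L0 hL]] := bl_bound hT.
have Le : (0 <= L / eps) by apply: Rmult_le_pos => //; left; apply: Rinv_0_lt_compat.
(* With this [m] both [1 <= m] and [L <= m * eps] hold, so [L ^ n <= m ^ n * eps ^ n <= m ^ N * eps
   ^ n] for the finitely many [n < N]. *)
set m := (1 + L / eps).
have m1 : (1 <= m) by rewrite /m; lra.
exists (m ^ N); split; first by apply: pow_le; lra.
move=> n; have en : (0 < eps ^ n) by apply: pow_lt.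
case: (Compare_dec.le_lt_dec N n) => h.
- apply: opnorm_le_weaken (hN n h).
  have := pow_R1_Rle m N m1; nra.
- apply: opnorm_le_weaken (opnorm_le_iter _ L n L0 hL).
  apply: (Rle_trans _ ((m * eps) ^ n)).
    apply: pow_incr; split=> //.
    have -> : (m * eps = eps + L) by rewrite /m; field; lra.
    lra.
  rewrite Rpow_mult_distr; apply: Rmult_le_compat_r; first lra.
  by apply: Rle_pow => //; lia.
Qed.

(** A constant factor is harmless: the bound is taken at [eps / 2], and the gained [2^(-n)]
    eventually absorbs [K]. *)
Lemma quasinilpotent_of_bound {X : Banach} (T : X -> X) :
  (forall eps, (0 < eps) ->
     exists K N, forall n, (N <= n)%nat -> opnorm_le (T ^^ n) (K * eps ^ n)) ->
  quasinilpotent T.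
Proof.
move=> h eps he; have [K [N hN]] := h (eps * /2) ltac:(lra).
have [N' hN'] := half_pow_small K 1 ltac:(lra).
exists (N + N')%nat => n hn; apply: opnorm_le_weaken (hN n _); last lia.
have en : (0 < eps ^ n) by apply: pow_lt.
have := hN' n ltac:(lia); rewrite Rpow_mult_distr; nra.
Qed.

Lemma quasinilpotent_ext {X : Banach} (f g : X -> X) :
  (forall x, f x = g x) -> quasinilpotent f -> quasinilpotent g.
Proof.
move=> e h eps he; have [N hN] := h eps he; exists N => n hn x.
have -> : (g ^^ n) x = (f ^^ n) x; last exact: hN.
by elim: n {hn} => //= n ->; rewrite e.
Qed.

(** * The direct sum as a Banach space *)

Lemma prod_complete (X Y : Banach) (u : nat -> prod_ops X Y) :
  (forall eps, (0 < eps) -> exists N, forall m n, (N <= m)%nat -> (N <= n)%nat ->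
     (vnorm (vsub (u m) (u n)) < eps)) ->
  exists l : prod_ops X Y, forall eps, (0 < eps) -> exists N, forall n, (N <= n)%nat ->
     (vnorm (vsub (u n) l) < eps).
Proof.
move=> hu.
have [l hl] : exists l : X, forall eps, (0 < eps) -> exists N, forall n, (N <= n)%nat ->
    (vnorm (vsub (fst (u n)) l) < eps).
  apply: complete => eps /hu [N hN]; exists N => m n hm hn.
  have := hN m n hm hn => /=; have := norm_nonneg Y (vsub (snd (u m)) (snd (u n))).
  by rewrite /vsub; lra.
have [k hk] : exists k : Y, forall eps, (0 < eps) -> exists N, forall n, (N <= n)%nat ->
    (vnorm (vsub (snd (u n)) k) < eps).
  apply: complete => eps /hu [N hN]; exists N => m n hm hn.
  have := hN m n hm hn => /=; have := norm_nonneg X (vsub (fst (u m)) (fst (u n))).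
  by rewrite /vsub; lra.
exists (l, k) => eps he.
have [N hN] := hl (eps / 2) ltac:(lra); have [N' hN'] := hk (eps / 2) ltac:(lra).
exists (N + N')%nat => n hn.
have := hN n ltac:(lia); have := hN' n ltac:(lia); rewrite /vsub /=; lra.
Qed.

(** The definition is transparent so that its operations reduce to [prod_ops X Y], on which
    [opmatrix] acts; only the proofs of the axioms are sealed. *)
Definition prod_banach (X Y : Banach) : Banach.
Proof.
refine (@Build_Banach (prod_ops X Y) _ _ _ _ _ _ _ _ _ _ _ _ (prod_complete X Y)).
- abstract (by move=> x y z /=; rewrite !add_assoc).
- abstract (by move=> x y /=; rewrite (add_comm _ (fst x)) (add_comm _ (snd x))).
- abstract (by move=> [x y] /=; rewrite !add_zero).
- abstract (by move=> x /=; rewrite !add_opp).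
- abstract (by move=> [x y] /=; rewrite !scal_one).
- abstract (by move=> a b x /=; rewrite !scal_assoc).
- abstract (by move=> a x y /=; rewrite !scal_distr_v).
- abstract (by move=> a b x /=; rewrite !scal_distr_s).
- abstract (by move=> x /=; apply: Rplus_le_le_0_compat; exact: norm_nonneg).
- abstract (move=> [x y] /= h; have hx := norm_nonneg X x; have hy := norm_nonneg Y y;
    by congr pair; apply: norm_zero; lra).
- abstract (by move=> a x /=; rewrite !norm_scal; ring).
- abstract (move=> x y /=; have := norm_triangle X (fst x) (fst y);
    have := norm_triangle Y (snd x) (snd y); lra).
Defined.
Canonical prod_banach.

(** * The equation [Z = B + F Z G] *)

Lemma zero_of_half_pow_bound {X : Banach} (x : X) c :
  (forall n, vnorm x <= c * (/2) ^ n) -> x = vzero.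
Proof.
move=> h; apply: norm_zero; apply: Rle_antisym; last exact: norm_nonneg.
apply: Rnot_lt_le => /(half_pow_small c) [N hN].
have := hN N (le_n N); have := h N; lra.
Qed.

(* [Z] is the sum of the series of the operators [F^n B G^n]. *)
Lemma stein_equation_solvable {X Y : Banach} (F : X -> X) (G : Y -> Y) (B : Y -> X) (K : R) :
  bounded_linear F -> bounded_linear G -> bounded_linear B -> (0 <= K) ->
  (forall n, opnorm_le (fun y => (F ^^ n) (B ((G ^^ n) y))) (K * (/2) ^ n)) ->
  exists Z : Y -> X, bounded_linear Z /\ forall y, Z y = B y ⊕ F (Z (G y)).
Proof.
move=> hF hG hB hK hn.
pose part := fix part n y := if n is S m then B y ⊕ F (part m (G y)) else vzero.
have blS n : bounded_linear (part n).
  elim: n => [|n IH] /=; first exact: bl_zero.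
  by apply: bl_add => //; apply: (bl_comp hF); apply: (bl_comp IH).
have Sstep n : forall y, vsub (part (S n) y) (part n y) = (F ^^ n) (B ((G ^^ n) y)).
  elim: n => [|n IH] y; first by rewrite /= (bl0 hF); abel.
  by rewrite (Nat.iter_succ_r n _ G) Nat.iter_succ -IH /=; linear; abel.

(* A geometric sum of the increments [m] to [k + m - 1], which gives the factor 2. The subtracted
   term makes the induction on [k] close. *)
have Sdiff m k y : vnorm (vsub (part (k + m)%nat y) (part m y))
    <= 2 * K * vnorm y * ((/2) ^ m - (/2) ^ (k + m)).
  elim: k => [|k IH] /=.
    by rewrite /vsub add_opp norm0; lra.
  apply: Rle_trans (norm_sub_triangle _ (part (k + m)%nat y) _) _.
  have := hn (k + m)%nat y; rewrite -Sstep /= => h; lra.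
have Scauchy m k y : (m <= k)%nat ->
    vnorm (vsub (part k y) (part m y)) <= 2 * K * vnorm y * (/2) ^ m.
  move=> hmk; have -> : k = (k - m + m)%nat by lia.
  have := Sdiff m (k - m)%nat y.
  have p0 : 0 < (/2) ^ (k - m + m) by apply: pow_lt; lra.
  have := Rmult_le_pos _ _ hK (norm_nonneg _ y); nra.
have sub_sym (x z : X) : vnorm (vsub x z) = vnorm (vsub z x).
  by rewrite -norm_opp; congr vnorm; abel.
have lim y : exists l : X, forall n, vnorm (vsub (part n y) l) <= 2 * K * vnorm y * (/2) ^ n.
  have [|l hl] := complete X (fun n => part n y).
    move=> eps he; have [N hN] := half_pow_small (2 * (2 * K * vnorm y)) eps he.
    exists N => m n hm hk; apply: Rle_lt_trans (hN N (le_n N)).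
    apply: Rle_trans (norm_sub_triangle _ (part N y) _) _.
    rewrite (sub_sym (part N y)).
    have := Scauchy N m y hm; have := Scauchy N n y hk; lra.
  (* The Cauchy estimate passes to the limit, giving an explicit rate of convergence. *)
  exists l => n; apply: Rle_plus_epsilon => eps /hl [N hN].
  apply: Rle_trans (norm_sub_triangle _ (part (n + N)%nat y) _) _.
  rewrite (sub_sym (part n y)).
  have := hN (n + N)%nat ltac:(lia); have := Scauchy n (n + N)%nat y ltac:(lia); lra.
(* The limits are chosen pointwise. Linearity and the equation are then recovered by writing each
   defect as a combination of errors [part n - Z], which decay like [2^(-n)]. *)
pose Z y := proj1_sig (constructive_indefinite_description _ (lim y)).
have hZ y n : vnorm (vsub (part n y) (Z y)) <= 2 * K * vnorm y * (/2) ^ n.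
  by rewrite /Z; case: constructive_indefinite_description.
exists Z; split; first split; [|split|].
- move=> x y; apply: sub_eq_zero; apply: (zero_of_half_pow_bound _
    (2 * K * vnorm (x ⊕ y) + 2 * K * vnorm x + 2 * K * vnorm y)) => n.
  have -> : Z (x ⊕ y) ⊕ ⊖ (Z x ⊕ Z y) = vsub (part n x) (Z x)
      ⊕ (vsub (part n y) (Z y) ⊕ ⊖ vsub (part n (x ⊕ y)) (Z (x ⊕ y))).
    by rewrite (blD (blS n)); abel.
  apply: Rle_trans (norm_triangle _ _ _) _.
  have := norm_triangle _ (vsub (part n y) (Z y)) (⊖ vsub (part n (x ⊕ y)) (Z (x ⊕ y))).
  rewrite norm_opp; have := hZ x n; have := hZ y n; have := hZ (x ⊕ y) n; lra.
- move=> a x; apply: sub_eq_zero; apply: (zero_of_half_pow_bound _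
    (2 * K * vnorm (vscal a x) + Cabs a * (2 * K * vnorm x))) => n.
  have -> : Z (vscal a x) ⊕ ⊖ vscal a (Z x) = vscal a (vsub (part n x) (Z x))
      ⊕ ⊖ vsub (part n (vscal a x)) (Z (vscal a x)).
    case: (blS n) => _ [-> _]; rewrite /vsub scal_distr_v scal_opp; abel.
  apply: Rle_trans (norm_triangle _ _ _) _.
  rewrite norm_opp norm_scal Rmult_plus_distr_r Rplus_comm.
  apply: Rplus_le_compat; first exact: hZ.
  by rewrite Rmult_assoc; apply: Rmult_le_compat_l; [exact: sqrt_pos | exact: hZ].
(* As [part 0] vanishes, the error bound at 0 bounds [Z y] itself. *)
- exists (2 * K) => y; have := hZ y 0%nat.
  by rewrite /= /vsub zero_add norm_opp Rmult_1_r.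
- have [L [L0 hL]] := bl_bound hF.
  move=> y; apply: sub_eq_zero; apply: (zero_of_half_pow_bound _
    (2 * K * vnorm y + L * (2 * K * vnorm (G y)))) => n.
  have -> : Z y ⊕ ⊖ (B y ⊕ F (Z (G y))) =
      F (vsub (part n (G y)) (Z (G y))) ⊕ ⊖ vsub (part (S n) y) (Z y).
    by rewrite /=; linear; abel.
  apply: Rle_trans (norm_triangle _ _ _) _.
  rewrite norm_opp Rmult_plus_distr_r Rplus_comm; apply: Rplus_le_compat.
    apply: Rle_trans (hZ y (S n)) _ => /=.
    have p0 : 0 < (/2) ^ n by apply: pow_lt; lra.
    have := Rmult_le_pos _ _ hK (norm_nonneg _ y); nra.
  rewrite Rmult_assoc; apply: Rle_trans (hL _) _.
  by apply: Rmult_le_compat_l => //; exact: hZ.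
Qed.

(** * Triangular matrices with quasinilpotent diagonal *)

(** The upper row of the [n]-th power consists of [q^n] and of [n] terms [q^i b p^(n-1-i)], each
    bounded by [K e^(n-1)]; the factor [e] on the left avoids the exponent [n - 1]. The extra
    [q ^^ m] makes the induction work, since peeling off one matrix factor raises [m] by one. *)
Lemma triangular_iter {X Y : Banach} (q : X -> X) (b : Y -> X) (p : Y -> Y) (K e : R) :
  bounded_linear q -> 0 <= K -> 0 < e ->
  (forall n, opnorm_le (q ^^ n) (K * e ^ n)) ->
  (forall m n, opnorm_le (fun y => (q ^^ m) (b ((p ^^ n) y))) (K * e ^ (m + n))) ->
  forall n m z, 
  let w := ((opmatrix q b (fun _ => vzero) p) ^^ n) z in
  snd w = (p ^^ n) (snd z) /\
  vnorm ((q ^^ m) (fst w)) * e <= K * e ^ (m + n) * (e * vnorm (fst z) + INR n * vnorm (snd z)).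
Proof.
move=> hq hK he hqn hb n; elim: n => [|n IH] m z.
  split=> //=; rewrite Nat.add_0_r Rmult_0_l; have := hqn m (fst z); nra.
move=> w1; pose w := ((opmatrix q b (fun _ => vzero) p) ^^ n) z.
have [h2 _] := IH m z; rewrite -/w in h2.
have -> : w1 = (q (fst w) ⊕ b (snd w), vzero ⊕ p (snd w)) by [].
split; first by rewrite /= zero_add h2.
rewrite [fst _]/= S_INR (blD (bl_iter m hq)) -Nat.iter_succ_r h2.
have [_ h1] := IH (S m) z; have h3 := hb m n (snd z).
have := norm_triangle _ ((q ^^ S m) (fst w)) ((q ^^ m) (b ((p ^^ n) (snd z)))).
have -> : (m + S n = S (m + n))%nat by lia.
rewrite -/w /= in h1 h3 *; nra.
Qed.

Lemma INR_le_pow2 n : INR n <= 2 ^ n.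
Proof.
elim: n => [|n IH]; first by rewrite /=; lra.
have := pow_R1_Rle 2 n ltac:(lra); rewrite S_INR /=; lra.
Qed.

Lemma opnorm_le_iter_comp {X Y : Banach} (F : X -> X) (B : Y -> X) (G : Y -> Y) K L M a c :
  0 <= K -> 0 <= L -> 0 < a ->
  (forall n, opnorm_le (F ^^ n) (K * a ^ n)) -> opnorm_le B L ->
  (forall n, opnorm_le (G ^^ n) (M * c ^ n)) ->
  forall m n, opnorm_le (fun y => (F ^^ m) (B ((G ^^ n) y))) (K * L * M * (a ^ m * c ^ n)).
Proof.
move=> hK hL ha hF hB hG m n.
have -> : K * L * M * (a ^ m * c ^ n) = K * a ^ m * (L * (M * c ^ n)) by ring.
apply: (opnorm_le_comp (F ^^ m) (fun y => B ((G ^^ n) y))) => //.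
  by apply: Rmult_le_pos => //; apply: pow_le; lra.
exact: opnorm_le_comp.
Qed.

Lemma quasinilpotent_triangular {X Y : Banach} (q : X -> X) (b : Y -> X) (p : Y -> Y) :
  bounded_linear q -> bounded_linear b -> bounded_linear p ->
  quasinilpotent q -> quasinilpotent p ->
  quasinilpotent (opmatrix q b (fun _ => vzero) p).
Proof.
move=> hq hb hp qq qp; apply: (@quasinilpotent_of_bound (prod_banach X Y)) => eps he.
(* Halving [eps] leaves a spare [2 ^ n], which absorbs the number [n] of corner terms. *)
have e0 : 0 < eps / 2 by lra.
have [K1 [K10 h1]] := quasinilpotent_bound _ hq qq e0.
have [K2 [K20 h2]] := quasinilpotent_bound _ hp qp e0.
have [L [L0 hL]] := bl_bound hb.
set e := eps / 2 in e0 h1 h2.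
have K120 : 0 <= K1 * L * K2 by apply: Rmult_le_pos => //; apply: Rmult_le_pos.
pose K := K1 + K1 * L * K2.
have K0 : 0 <= K by rewrite /K; lra.
have hK n : opnorm_le (q ^^ n) (K * e ^ n).
  apply: opnorm_le_weaken (h1 n); apply: Rmult_le_compat_r; first by apply: pow_le; lra.
  by rewrite /K; lra.
have hKb m n : opnorm_le (fun y => (q ^^ m) (b ((p ^^ n) y))) (K * e ^ (m + n)).
  apply: opnorm_le_weaken (opnorm_le_iter_comp q b p K1 L K2 e e K10 L0 e0 h1 hL h2 m n).
  rewrite -pow_add; apply: Rmult_le_compat_r; first by apply: pow_le; lra.
  by rewrite /K; lra.
(* [K] and [K / e] serve the contributions of [fst z] and [snd z] to the upper entry, [K2] the lower
   entry. The other products with [vnorm z] are the nonnegative terms [c1], [c2], [c3] below. *)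
exists (K + K / e + K2), 0%nat => n _ z.
have [hs hf] := triangular_iter q b p K e hq K0 e0 hK hKb n 0%nat z.
rewrite /= in hs hf; rewrite /= hs.
have hs2 := h2 n (snd z).
have epsE : eps = e * 2 by rewrite /e; field.
rewrite epsE Rpow_mult_distr.
have p0 : 0 < e ^ n by apply: pow_lt.
have p2 := pow_R1_Rle 2 n ltac:(lra); have pn := INR_le_pow2 n; have pn0 := pos_INR n.
have x0 := norm_nonneg _ (fst z); have y0 := norm_nonneg _ (snd z).
set w := fst _ in hf *; set x := vnorm (fst z) in hf x0 *; set y := vnorm (snd z) in hf y0 hs2 *.
have hf' : vnorm w <= K * e ^ n * (x + INR n * y / e).
  apply: (Rmult_le_reg_r e) => //.
  have -> : K * e ^ n * (x + INR n * y / e) * e = K * e ^ n * (e * x + INR n * y) by field; lra.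
  exact: hf.
have Ke0 : 0 <= K / e by apply: Rmult_le_pos => //; left; apply: Rinv_0_lt_compat.
have t1 : K * e ^ n * (x + INR n * y / e) <= (K * x + K / e * y) * (e ^ n * 2 ^ n).
  have -> : K * e ^ n * (x + INR n * y / e) = (K * x + K / e * (y * INR n)) * e ^ n by field; lra.
  have -> : (K * x + K / e * y) * (e ^ n * 2 ^ n) = (K * x * 2 ^ n + K / e * (y * 2 ^ n)) * e ^ n by ring.
  apply: Rmult_le_compat_r; first lra.
  apply: Rplus_le_compat; first by have := Rmult_le_pos _ _ K0 x0; nra.
  by apply: Rmult_le_compat_l => //; apply: Rmult_le_compat_l.
have t2 : K2 * e ^ n * y <= K2 * y * (e ^ n * 2 ^ n).
  have -> : K2 * y * (e ^ n * 2 ^ n) = K2 * e ^ n * y * 2 ^ n by ring.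
  have : 0 <= K2 * e ^ n * y by apply: Rmult_le_pos => //; apply: Rmult_le_pos => //; lra.
  nra.
have e2 : 0 <= e ^ n * 2 ^ n by apply: Rmult_le_pos; lra.
have c1 : 0 <= K * y * (e ^ n * 2 ^ n) by apply: Rmult_le_pos => //; apply: Rmult_le_pos.
have c2 : 0 <= K / e * x * (e ^ n * 2 ^ n) by apply: Rmult_le_pos => //; apply: Rmult_le_pos.
have c3 : 0 <= K2 * x * (e ^ n * 2 ^ n) by apply: Rmult_le_pos => //; apply: Rmult_le_pos.
lra.
Qed.

(** * The g-Drazin inverse of a triangular matrix *)

Lemma bl_opmatrix {X Y : Banach} {A : X -> X} {B : Y -> X} {Cc : X -> Y} {D : Y -> Y} :
  bounded_linear A -> bounded_linear B -> bounded_linear Cc -> bounded_linear D ->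
  bounded_linear (opmatrix A B Cc D).
Proof.
move=> hA hB hC hD; split; [|split].
- by move=> z w; rewrite /opmatrix /=; congr pair; linear; abel.
- move=> c z; case: hA => _ [hA _]; case: hB => _ [hB _]; case: hC => _ [hC _]; case: hD => _ [hD _].
  by rewrite /opmatrix /= hA hB hC hD !scal_distr_v.
- have [a [a0 ha]] := bl_bound hA; have [b [b0 hb]] := bl_bound hB.
  have [c [c0 hc]] := bl_bound hC; have [d [d0 hd]] := bl_bound hD.
  exists (a + b + c + d) => z /=.
  have := norm_triangle _ (A (fst z)) (B (snd z)); have := norm_triangle _ (Cc (fst z)) (D (snd z)).
  have := ha (fst z); have := hb (snd z); have := hc (fst z); have := hd (snd z).
  have := norm_nonneg _ (fst z); have := norm_nonneg _ (snd z); nra.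
Qed.

(** If one coefficient has norm at most [N], its powers grow at most like [(N + 1)^n], while those
    of the quasinilpotent one are [O((2 (N + 1))^(-n))]. The two rates multiply to [2^(-n)], so the
    series converges. *)
Lemma stein_equation_quasinilpotent_solvable {X Y : Banach}
    (F : X -> X) (G : Y -> Y) (B : Y -> X) :
  bounded_linear F -> bounded_linear G -> bounded_linear B ->
  quasinilpotent F \/ quasinilpotent G ->
  exists Z : Y -> X, bounded_linear Z /\ forall y, Z y = B y ⊕ F (Z (G y)).
Proof.
move=> hF hG hB hq; have [L [L0 hL]] := bl_bound hB.
suff [a [c [K [M [a0 [ac [K0 [M0 [hFn hGn]]]]]]]]] : exists a c K M,
    0 < a /\ a * c = /2 /\ 0 <= K /\ 0 <= M /\
    (forall n, opnorm_le (F ^^ n) (K * a ^ n)) /\ (forall n, opnorm_le (G ^^ n) (M * c ^ n)).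
  apply: (stein_equation_solvable F G B (K * L * M)) => //.
    by apply: Rmult_le_pos => //; apply: Rmult_le_pos.
  move=> n; rewrite -ac Rpow_mult_distr.
  exact: opnorm_le_iter_comp.
have pow_bound (E : Banach) (T : E -> E) N :
    0 <= N -> opnorm_le T N -> forall n, opnorm_le (T ^^ n) (1 * (N + 1) ^ n).
  move=> N0 hN n; rewrite Rmult_1_l; apply: opnorm_le_iter; first lra.
  by apply: opnorm_le_weaken hN; lra.
case: hq => hq.
- have [N [N0 hN]] := bl_bound hG.
  have c0 : 0 < / (2 * (N + 1)) by apply: Rinv_0_lt_compat; lra.
  have [K [K0 hK]] := quasinilpotent_bound _ hF hq c0.
  exists (/ (2 * (N + 1))), (N + 1), K, 1; do 5?split=> //; [field; lra | lra | exact: pow_bound].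
- have [N [N0 hN]] := bl_bound hF.
  have c0 : 0 < / (2 * (N + 1)) by apply: Rinv_0_lt_compat; lra.
  have [K [K0 hK]] := quasinilpotent_bound _ hG hq c0.
  exists (N + 1), (/ (2 * (N + 1))), 1, K; do 5?split=> //; [lra | field; lra | lra | exact: pow_bound].
Qed.

(* The diagonal of the inverse consists of [a] and [d]; writing [q], [p] for the
   quasinilpotent parts of [A], [D], the corner is [Z1 + Z2 - a B d] with
   [Z1 = a^2 B (1 - D d) + a Z1 p] and [Z2 = (1 - A a) B d^2 + q Z2 d]. *)
Lemma gDrazin_triangular {X Y : Banach} (A : X -> X) (B : Y -> X) (D : Y -> Y) :
  bounded_linear A -> bounded_linear B -> bounded_linear D ->
  has_gDrazin A -> has_gDrazin D ->
  has_gDrazin (opmatrix A B (fun _ => vzero) D).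
Proof.
move=> hA hB hD [a [ha [aAa [Aa qa]]]] [d [hd [dDd [Dd qd]]]].
pose q z := vsub (A z) (A (A (a z))); pose p z := vsub (D z) (D (D (d z))).
have hq : bounded_linear q by rewrite /q; bl.
have hp : bounded_linear p by rewrite /p; bl.
have [Z1 [hZ1 Z1E]] : exists Z : Y -> X, bounded_linear Z /\
    forall y, Z y = a (a (B (vsub y (D (d y))))) ⊕ a (Z (p y)).
  apply: (stein_equation_quasinilpotent_solvable a p (fun y => a (a (B (vsub y (D (d y))))))) => //.
    by bl.
  by right.
have [Z2 [hZ2 Z2E]] : exists Z : Y -> X, bounded_linear Z /\
    forall y, Z y = vsub (B (d (d y))) (A (a (B (d (d y))))) ⊕ q (Z (d y)).
  apply: (stein_equation_quasinilpotent_solvable q d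
    (fun y => vsub (B (d (d y))) (A (a (B (d (d y))))))) => //.
    by bl.
  by left.
have aaA x : a (a (A x)) = a x by rewrite -Aa aAa.
have ddD y : d (d (D y)) = d y by rewrite -Dd dDd.
(* The next four facts place the corner relative to the projections [A a] and [D d]:
   [Z1 = (A a) Z1 (1 - D d)] and [Z2 = (1 - A a) Z2 (D d)]. *)
have Z1l y : A (a (Z1 y)) = Z1 y.
  by rewrite (Z1E y); linear; rewrite !Aa !aaA.
have Z1r y : Z1 (D (d y)) = vzero.
  have e1 : vsub (D (d y)) (D (d (D (d y)))) = vzero by rewrite dDd; abel.
  have e2 : p (D (d y)) = vzero by rewrite /p dDd; abel.
  by rewrite Z1E e1 e2; linear; abel.
have Z2l y : A (a (Z2 y)) = vzero.
  by rewrite (Z2E y) /q; linear; rewrite !Aa !aaA; abel.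
have Z2r y : Z2 (D (d y)) = Z2 y.
  by rewrite Z2E (Dd y) ddD -Z2E.
(* The equation of [Z1] is multiplied by [A] on the left, that of [Z2] by [D] on the right. Together
   they give [A Z + B d = a B + Z D], the corner of the commutation relation. *)
have Z1D y : A (Z1 y) = a (B y) ⊕ ⊖ a (B (D (d y))) ⊕ Z1 (D y).
  have e1 : Z1 (p y) = Z1 (D y).
    by rewrite /p; linear; rewrite (Dd y) Z1r; abel.
  by rewrite (Z1E y) e1; linear; rewrite Z1l !Aa !aaA; abel.
have Z2D y : Z2 (D y) = B (d y) ⊕ ⊖ A (a (B (d y))) ⊕ A (Z2 y).
  by rewrite Z2E !ddD -Dd Z2r /q Z2l; linear; abel.
pose Z y := Z1 y ⊕ Z2 y ⊕ ⊖ a (B (d y)).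
have hZ : bounded_linear Z by rewrite /Z; bl.
have h0 : bounded_linear (fun _ : X => vzero : Y) by exact: bl_zero.
exists (opmatrix a Z (fun _ => vzero) d); split; [|split; [|split]].
- exact: bl_opmatrix.
- move=> [x y]; rewrite /opmatrix /= !zero_add dDd; congr pair; linear.
  have -> : a (A (Z y)) = Z1 y ⊕ ⊖ a (B (d y)).
    by rewrite -Aa /Z; linear; rewrite Z1l Z2l Aa aAa; abel.
  have -> : Z (D (d y)) = Z2 y ⊕ ⊖ a (B (d y)).
    by rewrite /Z Z1r Z2r dDd; abel.
  by rewrite aAa /Z; abel.
- move=> [x y]; rewrite /opmatrix /= !zero_add Dd; congr pair.
  by rewrite /Z; linear; rewrite Aa Z1D Z2D -!Dd; abel.
(* The remainder is again triangular, with the quasinilpotent [q] and [p] on its diagonal and a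
   bounded corner. *)
- apply: (@quasinilpotent_ext (prod_banach X Y)
    (opmatrix q (fun y => vsub (B y) (A (A (Z y) ⊕ B (d y)) ⊕ B (D (d y)))) (fun _ => vzero) p)).
    move=> [x y]; rewrite /opmatrix /vsub /= !zero_add /q /p /vsub.
    by congr pair; linear; abel.
  by apply: quasinilpotent_triangular => //; bl; apply: bl_comp hA _; bl.
Qed.

(** * Transfer of the g-Drazin inverse from [T] to [M] *)

Lemma iter_comm {E : Type} (f g h : E -> E) n :
  (forall x, h (f x) = g (h x)) -> forall x, h ((f ^^ n) x) = (g ^^ n) (h x).
Proof. by move=> e; elim: n => //= n IH x; rewrite e IH. Qed.

(** The exponent 7 is chosen so that [W U s^7 = T^6 s^7 = s]. For the remainders [r] of [M] and [q]
    of [T] one has [W r = q W] and [r^2 = M r], whence [r^(n+7) = M^6 r^(n+1) = U W r^(n+1) = U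
    q^(n+1) W], and quasinilpotence passes from [q] to [r]. *)
Lemma gDrazin_intertwined {E : Banach} (M T : E -> E) :
  bounded_linear M -> bounded_linear T ->
  (forall z, M (M (M (T z))) = M (M (T (T z)))) ->
  (forall z, T (T (M (M z))) = T (T (T (M z)))) ->
  (forall z, M (M (M (M z))) = M (M (T (M z)))) ->
  (forall z, T (T (M (T z))) = T (T (T (T z)))) ->
  has_gDrazin T -> has_gDrazin M.
Proof.
move=> hM hT e1 e2 e3 e4 [s [hs [sTs [Ts qT]]]].
pose U z := M (M (T z)); pose W z := T (T (M z)).
have hU : bounded_linear U by rewrite /U; bl.
have hW : bounded_linear W by rewrite /W; bl.
have MU z : M (U z) = U (T z) by exact: e1.
have WM z : W (M z) = T (W z) by exact: e2.
have UW z : U (W z) = (M ^^ 6) z by rewrite /U /W /= -!e1 -e3.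
have WU z : W (U z) = (T ^^ 6) z by rewrite /U /W /= !e2 e4.
clearbody U W.
have ssT z : s (s (T z)) = s z by rewrite -Ts sTs.
have sT7 z : (T ^^ 6) ((s ^^ 7) z) = s z by rewrite /= !Ts !ssT.
pose M_inv z := U ((s ^^ 7) (W z)).
have hS : bounded_linear M_inv by apply: (bl_comp hU); apply: (bl_comp (bl_iter 7 hs)).
have MS z : M (M_inv z) = M_inv (M z).
  by rewrite /M_inv MU WM (iter_comm s s T).
have SMS z : M_inv (M (M_inv z)) = M_inv z.
  by rewrite {1 2}/M_inv WM WU sT7 /M_inv /= sTs.
pose q z := vsub (T z) (T (T (s z))); pose r z := vsub (M z) (M (M (M_inv z))).
have hq : bounded_linear q by rewrite /q; bl.
have Wr z : W (r z) = q (W z).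
  rewrite /r /q; linear; rewrite !WM {1}/M_inv WU sT7; abel.
have Sr z : M_inv (r z) = vzero.
  by rewrite /r; linear; rewrite -(MS (M (M_inv z))) SMS -MS; abel.
have rr z : r (r z) = M (r z).
  by rewrite {1}/r Sr; linear; abel.
have riter n z : (r ^^ S n) z = (M ^^ n) (r z).
  by elim: n z => // n IH z; rewrite Nat.iter_succ_r IH rr -Nat.iter_succ_r.
have rUq n z : (r ^^ (n + 7)) z = U ((q ^^ S n) (W z)).
  rewrite -(iter_comm r q W) // UW riter.
  have -> : (n + 7 = S (6 + n))%nat by lia.
  by rewrite riter Nat.iter_add.
exists M_inv; do 3!split=> //; apply: quasinilpotent_of_bound => eps he.
have [K [K0 hK]] := quasinilpotent_bound eps hq qT he.
have [L [L0 hL]] := bl_bound hU; have [N [N0 hN]] := bl_bound hW.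
(* For [n >= 7] the power [r^n] contains only [q^(n-6)]; dividing by [eps ^ 6] makes up for the
   missing factors. *)
exists (L * K * N / eps ^ 6), 7%nat => n hn z.
have -> : n = (n - 7 + 7)%nat by lia.
rewrite rUq; move: (n - 7)%nat => m.
have -> : L * K * N / eps ^ 6 * eps ^ (m + 7) = L * (K * eps ^ S m * N).
  by rewrite pow_add /=; field; lra.
have em : 0 <= K * eps ^ S m by apply: Rmult_le_pos => //; apply: pow_le; lra.
exact: (opnorm_le_comp U (fun z => (q ^^ S m) (W z)) _ _ L0 hL (opnorm_le_comp _ W _ _ em (hK _) hN)).
Qed.

Theorem theorem3p1 (X Y : Banach)
  (A : X -> X) (B : Y -> X) (Cc : X -> Y) (D : Y -> Y)
  (hA : bounded_linear A) (hB : bounded_linear B)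
  (hC : bounded_linear Cc) (hD : bounded_linear D)
  (hAd : has_gDrazin A) (hDd : has_gDrazin D)
  (h1 : forall x : X, A (B (Cc x)) = vzero)
  (h2 : forall x : X, D (Cc (A x)) = vzero)
  (h3 : forall y : Y, D (Cc (B y)) = vzero)
  (h4 : forall x : X, Cc (B (Cc (A x))) = vzero)
  (h5 : forall y : Y, Cc (B (Cc (B y))) = vzero) :
  has_gDrazin (opmatrix A B Cc D).
Proof.
have h0 : bounded_linear (fun _ : X => vzero : Y) by exact: bl_zero.
(* With [N = M - T], the four identities say that [M^2 N T], [T^2 N M], [M^2 N M] and [T^2 N T]
   vanish. Both [N M] and [N T] send [(x, y)] to [(0, v)] with [v = Cc (A x + B y)]. Then [D v = 0]
   by [h2] and [h3], so the next factor gives [(B v, 0)], and the last one kills it because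
   [A B v = 0] by [h1] and [Cc B v = 0] by [h4] and [h5]. *)
apply: (@gDrazin_intertwined (prod_banach X Y) _ (opmatrix A B (fun _ => vzero) D));
  [exact: bl_opmatrix | exact: bl_opmatrix | | | | | exact: gDrazin_triangular];
  move=> [x y]; rewrite /opmatrix /= !zero_add; linear;
  rewrite ?(h1, h2, h3, h4, h5); linear; rewrite ?(h1, h2, h3, h4, h5); congr pair; abel.
Qed.
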